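(* For all integers $n,m\ge 0$, $$S_q(n,m)=\sum_{\lambda\vdash n,\ l(\lambda)=m} q^{\sum_i (i-1)(\lambda_i-1)}\sum_{T\in\mathrm{Tab}_{[n]}(\lambda)} c_q(T).$$
   Context: The $q$-Stirling numbers of the second kind are defined by $S_q(n,m)=S_q(n-1,m-1)+[m]_qS_q(n-1,m)$ for $n,m\ge1$, and $S_q(n,m)=\delta_{nm}$ if $n=0$ or $m=0$, where $[a]_q=1+q+\dots+q^{a-1}$. $l(\lambda)$ is the number of parts of $\lambda$, and $\mathrm{Tab}_{[n]}(\lambda)$ is the set of standard tableaux of shape $\lambda$ (fillings of the Young diagram of $\lambda$ with $1,\dots,n$, rows increasing left to right, columns increasing top to bottom). For such $T$ and $2\le j\le\lambda_i$, $c_{ij}(T)=\#\{i'\ge i:\text{cell }(i',j-1)\text{ exists and }T_{i',j-1}<T_{ij}\}$ and $c_q(T)=\prod_i\prod_{j=2}^{\lambda_i}[c_{ij}(T)]_q$. *)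

(* Defs.v *)
From mathcomp Require Import all_boot all_order all_algebra.
Set Implicit Arguments.
Unset Strict Implicit.
Unset Printing Implicit Defensive.
Import GRing.Theory.

(* Rows and columns are numbered from 0: entry T i j below is the entry
   T_{i+1,j+1} of the usual 1-based convention, lambda_{i+1} is nth 0 lam i. *)

Definition is_partition (n : nat) (lam : seq nat) : bool :=
  [&& sorted geq lam, 0 \notin lam & sumn lam == n].

(* A partition of n has at most n parts, each at most n, so filtering the
   bounded sequences loses nothing: see mem_partitions. *)
Definition partitions (n : nat) : seq (seq nat) :=
  [seq lam <- [seq map val (val b) | b <- enum {: n.-bseq 'I_n.+1}]
     | is_partition n lam].

Lemma partitions_uniq n : uniq (partitions n).
Proof.
apply/filter_uniq; rewrite map_inj_uniq ?enum_uniq // => b c /= eqbc.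
by apply/val_inj/(inj_map val_inj).
Qed.

Lemma mem_partitions n lam : (lam \in partitions n) = is_partition n lam.
Proof.
rewrite mem_filter; case: (boolP (is_partition n lam)) => //= /and3P[_ n0 /eqP sn].
have sz : size lam <= n.
  rewrite -sn; elim: lam n0 {sn} => //= x s IHs.
  rewrite inE negb_or eq_sym => /andP[x0 /IHs le_s].
  by rewrite -add1n leq_add // lt0n.
have bnd x : x \in lam -> x < n.+1.
  rewrite ltnS -sn; elim: lam {n0 sn sz} => //= y s IHs.
  rewrite inE => /orP[/eqP->|/IHs le_x]; first exact: leq_addr.
  exact: leq_trans le_x (leq_addl _ _).
have szb : size (map (@inord n) lam) <= n by rewrite size_map.
apply/mapP; exists (Bseq szb); first by rewrite mem_enum.
rewrite /= -map_comp -[LHS]map_id; apply/eq_in_map => x /bnd x_lt /=.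
by rewrite inordK.
Qed.

(* A filling is the sequence of its rows. *)
Definition entry (T : seq (seq nat)) (i j : nat) : nat :=
  nth 0 (nth [::] T i) j.

Definition columns_increasing (T : seq (seq nat)) : bool :=
  all (fun i => all (fun j => entry T i j < entry T i.+1 j)
                    (iota 0 (size (nth [::] T i.+1))))
      (iota 0 (size T).-1).

Definition is_standard_tableau (n : nat) (lam : seq nat) (T : seq (seq nat)) :
    bool :=
  [&& shape T == lam, perm_eq (flatten T) (iota 1 n),
      all (sorted ltn) T & columns_increasing T].

Definition Tab (n : nat) (lam : seq nat) : seq (seq (seq nat)) :=
  [seq T <- [seq reshape lam w | w <- permutations (iota 1 n)]
     | is_standard_tableau n lam T].

Lemma mem_Tab n lam T : (T \in Tab n lam) = is_standard_tableau n lam T.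
Proof.
rewrite mem_filter; case: (boolP (is_standard_tableau _ _ _)) => //=.
case/and4P=> /eqP shT perT _ _; apply/mapP; exists (flatten T).
  by rewrite mem_permutations.
by rewrite -shT flattenK.
Qed.

Lemma Tab_uniq n lam : sumn lam = n -> uniq (Tab n lam).
Proof.
move=> sn; apply/filter_uniq; rewrite map_inj_in_uniq ?permutations_uniq //.
move=> v w; rewrite !mem_permutations => /perm_size szv /perm_size szw.
move/(congr1 flatten).
by rewrite !reshapeKr // ?szv ?szw size_iota sn.
Qed.

Definition c_entry (T : seq (seq nat)) (i j : nat) : nat :=
  count (fun i' => (j.-1 < size (nth [::] T i'))
                   && (entry T i' j.-1 < entry T i j))
        (iota i (size T - i)).

Local Open Scope ring_scope.

Definition qnum (R : comNzRingType) (q : R) (a : nat) : R :=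
  \sum_(k < a) q ^+ k.

Fixpoint qStirling2 (R : comNzRingType) (q : R) (n m : nat) : R :=
  match n, m with
  | 0%N, 0%N => 1
  | 0%N, _.+1 => 0
  | _.+1, 0%N => 0
  | n'.+1, m'.+1 =>
      qStirling2 q n' m' + qnum q m'.+1 * qStirling2 q n' m'.+1
  end.

Definition cq (R : comNzRingType) (q : R) (lam : seq nat) (T : seq (seq nat)) :
    R :=
  \prod_(0 <= i < size lam) \prod_(1 <= j < nth 0%N lam i)
    qnum q (c_entry T i j).

(* sum_i (i - 1)(lambda_i - 1), with i shifted to start at 0. *)
Definition partition_weight (lam : seq nat) : nat :=
  (\sum_(0 <= i < size lam) i * (nth 0 lam i - 1))%N.

(* Main.v *)
(** Remove the largest entry [n] of a standard tableau [T].  Since [n] is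
    counted by none of the [c_ij] of the other cells, [c_q(T)] only loses the
    factor of the removed cell, and that factor depends on the shape alone: if
    the cell is in row [i] (from 0) and not in column 0, it is [[b]_q], where
    [b] is the number of rows below and including row [i] whose length, in the
    smaller shape, equals that of row [i].  The weight [q^(sum i (lambda_i - 1))]
    gains [q^i].  The rows that may be extended are the first rows of the
    blocks of equal parts, hence the factors [q^i [b]_q] add up to [[m]_q],
    while a new bottom row contributes the factor 1: this is the recurrence of
    the q-Stirling numbers. *)

Require Import Defs.
From mathcomp Require Import all_boot all_order all_algebra.
From mathcomp Require Import zify.
Import GRing.Theory.
Local Open Scope ring_scope.

(** * Telescoping over the blocks of equal parts *)

Lemma qnumS (R : comNzRingType) (q : R) a : qnum q a.+1 = 1 + q * qnum q a.
Proof.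
rewrite /qnum big_ord_recl mulr_sumr; congr (_ + _).
by apply: eq_bigr => i _; rewrite exprS.
Qed.

(* For a weakly decreasing [s], the length of the block of [nth 0 s i] from
   position [i] on. *)
Definition block (s : seq nat) (i : nat) : nat :=
  count (leq (nth 0%N s i)) (drop i s).

(** A block of length b starting at i contributes q^i + ... + q^(i+b-1), so the blocks tile
    [qnum q (size s)]. The bound [p] acts as a part preceding [s]: parts equal to [p] continue its
    block, open none, and are restored by the second summand. *)
Lemma sum_blocks_path (R : comNzRingType) (q : R) p s : path geq p s ->
  \sum_(0 <= i < size s | (nth 0 s i < nth 0 (p :: s) i)%N)
     q ^+ i * qnum q (block s i) + qnum q (count (leq p) s) = qnum q (size s).
Proof.
elim: s p => [|x s IHs] p /=; first by rewrite big_nil add0r.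
case/andP=> le_xp path_xs.
rewrite big_mkcond big_nat_recl //= -big_mkcond /= /block /=.
under eq_bigr do rewrite exprS -mulrA.
rewrite -mulr_sumr leqnn mul1r add1n !qnumS -(IHs _ path_xs).
(* Either [x < p] opens a block and no part of [s] reaches [p], or [x = p] merely lengthens the
   block of [p] and index 0 is left out of the sum. *)
case: (ltngtP x p) le_xp => // [lt_xp | ->] _; last by rewrite qnumS add0r mulrDr addrCA.
have -> : count (leq p) s = 0%N.
  apply/eqP; rewrite -leqn0 leqNgt -has_count -all_predC.
  move: path_xs; rewrite path_sortedE; last by move=> a b c /= ab bc; lia.
  by case/andP=> /allP le_sx _; apply/allP=> y /le_sx /=; lia.
rewrite [X in _ + X](_ : _ = 0); last exact: big_ord0.
by rewrite addr0 mulrDr -addrA [q * _ + _]addrC.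
Qed.

(** A fictitious top row of length [head + 1] makes row 0 always extendable. At [i = size s] the
    default 0 stands for an empty bottom row. *)
Definition addable (s : seq nat) (i : nat) : bool :=
  (nth 0 s i < nth 0 ((head 0 s).+1 :: s) i)%N.

(** Taking [p] above every part leaves no block to be continued, so the second summand of
    [sum_blocks_path] vanishes. *)
Lemma sum_blocks (R : comNzRingType) (q : R) s : sorted geq s ->
  \sum_(0 <= i < size s | addable s i) q ^+ i * qnum q (block s i)
  = qnum q (size s).
Proof.
move=> s_sorted; set p := (head 0 s).+1.
have path_ps : path geq p s by case: s s_sorted @p => //= x s -> /=; rewrite leqnSn.
rewrite -(sum_blocks_path R q p s path_ps).
suff -> : count (leq p) s = 0%N by rewrite [X in _ + X](_ : _ = 0) ?addr0 //; apply: big_ord0.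
case: s s_sorted @p {path_ps} => //= x s; rewrite path_sortedE; last by move=> a b c /=; lia.
case/andP=> /allP le_sx _; rewrite ltnn add0n; apply/eqP.
rewrite -leqn0 leqNgt -has_count -all_predC.
by apply/allP=> y /le_sx /=; lia.
Qed.

(** * Adding the largest entry to a tableau *)

Local Notation trow T a := (@nth (seq nat) [::] T a).

(** Rows past the end read as [[::]]; banning genuine empty rows lets the number of rows be
    recovered from the row function. *)
Lemma eq_rows (T U : seq (seq nat)) : [::] \notin T -> [::] \notin U ->
  (forall a, trow T a = trow U a) -> T = U.
Proof.
elim: T U => [|r T IHT] [|u U] //=.
- by move=> _ + /(_ 0%N) /= ru; rewrite /= in ru; rewrite -ru inE eqxx.
- by move=> + _ /(_ 0%N) ru; rewrite /= in ru; rewrite ru inE eqxx.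
rewrite !inE !negb_or => /andP[_ T0] /andP[_ U0] eqTU.
congr (_ :: _); first exact: (eqTU 0%N).
by apply: IHT => // a; apply: (eqTU a.+1).
Qed.

Lemma row_neq0 (T : seq (seq nat)) a :
  [::] \notin T -> (a < size T)%N -> (0 < size (trow T a))%N.
Proof.
by move=> T0 lt_a; rewrite lt0n size_eq0; apply: contraNneq T0 => <-; apply: mem_nth.
Qed.

(* The value [i = size T] starts a new bottom row. *)
Definition add_cell (k i : nat) (T : seq (seq nat)) : seq (seq nat) :=
  set_nth [::] T i (rcons (trow T i) k).

Lemma row_add k i T a :
  trow (add_cell k i T) a = if a == i then rcons (trow T i) k else trow T a.
Proof. exact: nth_set_nth. Qed.

Lemma size_row_add k i T a :
  size (trow (add_cell k i T) a) = (size (trow T a) + (a == i))%N.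
Proof. by rewrite row_add; case: eqP => [->|_]; rewrite ?size_rcons ?addn1 ?addn0. Qed.

Lemma entry_add k i T a b : entry (add_cell k i T) a b =
  if (a == i) && (b == size (trow T i)) then k else entry T a b.
Proof.
rewrite {1}/entry row_add; case: eqP => [->|//].
rewrite nth_rcons; case: ltngtP => //= lt_b.
by rewrite /entry nth_default // ltnW.
Qed.

Lemma perm_flatten_add k i T :
  perm_eq (flatten (add_cell k i T)) (k :: flatten T).
Proof.
rewrite /add_cell; elim: T i => [|r T IHT] [|i] /=.
- by [].
- by elim: i.
- by rewrite -cats1 -catA perm_catCA.
by rewrite -[k :: _]/([:: k] ++ r ++ _) perm_sym perm_catCA perm_sym perm_cat2l.
Qed.

Lemma nil_notin_add k i T : (i <= size T)%N -> [::] \notin T ->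
  [::] \notin add_cell k i T.
Proof.
rewrite /add_cell; elim: T i => [|r T IHT] [|i] //=.
  by rewrite !inE !negb_or => _ /andP[_ ->]; case: r.
by rewrite !inE !negb_or => le_i /andP[-> /(IHT _ le_i)].
Qed.

(** The shape stays implicit, so that it can vary when a cell is added. Rows past the end default to
    [[::]], so the conditions range over all [a]. *)
Record tableau (n : nat) (T : seq (seq nat)) : Prop := Tableau {
  tableau_rows : [::] \notin T;
  tableau_shape : forall a, (size (trow T a.+1) <= size (trow T a))%N;
  tableau_content : perm_eq (flatten T) (iota 1 n);
  tableau_row : forall a, sorted ltn (trow T a);
  tableau_column : forall a b, (b < size (trow T a.+1))%N ->
    (entry T a b < entry T a.+1 b)%N
}.

Lemma mem_row_flatten (T : seq (seq nat)) a k : k \in trow T a -> k \in flatten T.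
Proof.
move=> k_in; apply/flattenP; exists (trow T a) => //; apply: mem_nth.
by rewrite ltnNge; apply: contraL k_in => /(nth_default _)->.
Qed.

Lemma mem_row_leq n T a k : perm_eq (flatten T) (iota 1 n) ->
  k \in trow T a -> (k <= n)%N.
Proof.
by move=> /perm_mem eqT /mem_row_flatten; rewrite eqT mem_iota add1n ltnS => /andP[].
Qed.

Lemma entry_leq n T a b : perm_eq (flatten T) (iota 1 n) -> (entry T a b <= n)%N.
Proof.
move=> eqT; have [lt_b|le_b] := ltnP b (size (trow T a)).
  exact/(mem_row_leq _ _ _ _ eqT)/mem_nth.
by rewrite /entry nth_default.
Qed.

Lemma sorted_rcons_ltn s k :
  sorted ltn (rcons s k) = all (ltn^~ k) s && sorted ltn s.
Proof. by rewrite !(sorted_pairwise ltn_trans) pairwise_rcons. Qed.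

Lemma perm_flatten_addS n i T :
  perm_eq (flatten (add_cell n.+1 i T)) (iota 1 n.+1)
  = perm_eq (flatten T) (iota 1 n).
Proof.
rewrite (permPl (perm_flatten_add _ _ _)) -[in iota _ _](addn1 n) iotaD /= add1n.
by rewrite -cat1s perm_catC perm_cat2r.
Qed.

Lemma addableE T i :
  addable (shape T) i = (i == 0%N) || (size (trow T i) < size (trow T i.-1))%N.
Proof.
rewrite /addable nth_shape; case: i => [|i] /=; last by rewrite nth_shape.
by case: T => //= r T; rewrite ltnSn.
Qed.

(** As [n.+1] exceeds every other entry, the order conditions at the new cell reduce to its having
    nothing to its right or below, which is a matter of shape. *)
Lemma tableau_add n i T : (i <= size T)%N -> [::] \notin T ->
  tableau n.+1 (add_cell n.+1 i T) <-> tableau n T /\ addable (shape T) i.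
Proof.
move=> le_i T0; rewrite addableE; split=> [[_ shT contT rowT colT]|[]].
  have contT' := contT; rewrite perm_flatten_addS in contT'.
  split; last by case: i {le_i contT rowT colT} shT => //= i /(_ i); rewrite !size_row_add eqxx; lia.
  split=> // [a|a|a b lt_b].
  - have := shT a; rewrite !size_row_add; have [->|_] := eqVneq a i; last by lia.
    rewrite [_ == _](_ : _ = false) ?addn0 ?addn1 => [le_a|]; last by lia.
    (* Were row [i.+1] longer than row [i], an old entry, at most [n], would lie below the new
       [n.+1]. *)
    rewrite leqNgt; apply/negP => lt_a.
    have := colT i (size (trow T i)); rewrite !entry_add size_row_add !eqxx /=.
    rewrite [_ == _](_ : _ = false) /=; last by lia.
    rewrite addn0 => /(_ lt_a).
    by have := entry_leq _ _ i.+1 (size (trow T i)) contT'; lia.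
  - have := rowT a; rewrite row_add; case: eqP => // ->.
    by rewrite sorted_rcons_ltn => /andP[].
  have := colT a b; rewrite size_row_add !entry_add => /(_ (leq_trans lt_b (leq_addr _ _))).
  have -> : (a.+1 == i) && (b == size (trow T i)) = false.
    by apply/negP=> /andP[/eqP ai /eqP bi]; move: lt_b; rewrite bi ai ltnn.
  by have := entry_leq _ _ a.+1 b contT'; case: ifP => //; lia.
case=> _ shT contT rowT colT add_i.
split=> [|a||a|a b].
- exact: nil_notin_add.
- rewrite !size_row_add; have := shT a.
  by have [ai|_] := eqVneq a.+1 i; [move: add_i; rewrite -ai /=|]; lia.
- by rewrite perm_flatten_addS.
- rewrite row_add; case: eqP => // _; rewrite sorted_rcons_ltn rowT andbT.
  by apply/allP=> k /(mem_row_leq _ _ _ _ contT); rewrite /= ltnS.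
rewrite size_row_add !entry_add => lt_b.
have [/andP[/eqP ai _]|not_new] := boolP ((a.+1 == i) && (b == size (trow T i))).
  rewrite [a == i](_ : _ = false) /=; last by lia.
  by rewrite ltnS; apply: entry_leq.
have lt_b' : (b < size (trow T a.+1))%N.
  by move: lt_b not_new; have [<-|_] := eqVneq a.+1 i => /=; lia.
have -> : (a == i) && (b == size (trow T i)) = false.
  apply/negP=> /andP[/eqP ai /eqP bi]; have := shT a.
  by move: lt_b'; rewrite bi ai; lia.
exact: colT.
Qed.

(** Growth along rows puts [n.+1] at the end of its row, from which it can be deleted. *)
Lemma tableau_remove n T : tableau n.+1 T ->
  exists T0 i, [/\ (i <= size T0)%N, [::] \notin T0 & T = add_cell n.+1 i T0].
Proof.
move=> tabT; have [T0 _ contT rowT colT] := tabT.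
have : n.+1 \in flatten T by rewrite (perm_mem contT) mem_iota; lia.
case/flattenP=> _ /(nthP [::])[i lt_i <-] n_in.
have rowE : exists r, trow T i = rcons r n.+1.
  have := rowT i; have := mem_row_leq _ _ i _ contT; move: n_in.
  case/lastP: (trow T i) => // r x n_in le_n sorted_r; exists r; congr rcons.
  move: n_in; rewrite mem_rcons inE => /orP[/eqP//|n_in].
  have := le_n x; rewrite mem_rcons mem_head => /(_ isT).
  move: sorted_r; rewrite sorted_rcons_ltn => /andP[/allP/(_ _ n_in) /=].
  by lia.
have [r row_i] := rowE.
(* If [n.+1] is alone in its row, the whole row must go, since empty rows are banned; growth down
   columns makes it the bottom row. *)
have [r0|r_neq0] := eqVneq r [::].
  have szT : size T = i.+1.
    apply/eqP; rewrite eqn_leq lt_i andbT leqNgt; apply/negP => lt_i1.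
    have := colT i 0%N (row_neq0 _ _ T0 lt_i1).
    have := entry_leq _ _ i.+1 0%N contT.
    by rewrite {2}/entry row_i r0 /=; lia.
  exists (take i T), i; rewrite size_take szT ltnSn leqnn; split=> //.
    by apply: contra T0; apply: mem_take.
  rewrite /add_cell set_nthE size_take szT ltnSn ltnn subnn /= nth_default; last first.
    by rewrite size_take szT ltnSn.
  by rewrite -{1}(cat_take_drop i T) (drop_nth [::] lt_i) row_i r0 drop_oversize ?szT.
have U0 : [::] \notin set_nth [::] T i r.
  rewrite set_nthE lt_i mem_cat inE !negb_or eq_sym r_neq0 /=; apply/andP; split.
    by apply: contra T0; apply: mem_take.
  by apply: contra T0; apply: mem_drop.
have le_i : (i <= size (set_nth [::] T i r))%N by rewrite size_set_nth; lia.
exists (set_nth [::] T i r), i; split=> //.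
apply: eq_rows => // [|a]; first exact: nil_notin_add.
by rewrite row_add !nth_set_nth /= eqxx; case: eqP => // ->.
Qed.

(** Since [k] is fresh, only the extended row contains it, which reveals the index; stripping [k]
    from that row recovers the rest. *)
Lemma add_cell_inj k i j T U : k \notin flatten T -> k \notin flatten U ->
  [::] \notin T -> [::] \notin U ->
  add_cell k i T = add_cell k j U -> i = j /\ T = U.
Proof.
move=> kT kU T0 U0 eqTU.
have ij : i = j.
  apply/eqP; apply: contraNT kU => ne_ij; apply: (@mem_row_flatten U i).
  have := row_add k j U i; rewrite -eqTU row_add eqxx (negbTE ne_ij) => <-.
  by rewrite mem_rcons mem_head.
split=> //; apply: eq_rows => // a.
have := congr1 (fun V => trow V a) eqTU; rewrite /= !row_add -ij.
by case: eqP => // -> /rcons_inj[].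
Qed.

(** * Enumerating standard tableaux by successive insertions *)

Lemma nth_partition_leq lam a : sorted geq lam ->
  (nth 0 lam a.+1 <= nth 0 lam a)%N.
Proof.
have [lt_a|le_a] := ltnP a.+1 (size lam); last by rewrite nth_default.
by move=> /(sortedP 0%N)/(_ _ lt_a).
Qed.

Lemma tableauP n lam T :
  reflect (tableau n T /\ shape T = lam)
          (is_partition n lam && is_standard_tableau n lam T).
Proof.
apply: (iffP andP) => [[/and3P[lam_geq lam0 _]]|[[T0 shT contT rowT colT] <-]].
  case/and4P=> /eqP shTE contT rowT colT; split=> //; rewrite -shTE in lam_geq lam0.
  split=> // [|a|a|a b lt_b].
  - by apply: contra lam0 => /(map_f size).
  - by have := nth_partition_leq _ a lam_geq; rewrite !nth_shape.
  - have [lt_a|le_a] := ltnP a (size T); last by rewrite nth_default.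
    by move/allP: rowT; apply; apply: mem_nth.
  have lt_a : (a.+1 < size T)%N.
    by rewrite ltnNge; apply: contraTN lt_b => /(nth_default _)->.
  move/allP: colT => /(_ a); rewrite mem_iota => /(_ ltac:(lia)) /allP /(_ b).
  by rewrite mem_iota; apply; rewrite lt_b.
split; last first.
  apply/and4P; split=> //.
    by apply/allP=> _ /(nthP [::])[a _ <-].
  by apply/allP=> a _; apply/allP=> b; rewrite mem_iota => /andP[_]; apply: colT.
apply/and3P; split; last by rewrite -size_flatten (perm_size contT) size_iota.
- by apply/(sortedP 0%N)=> a _; rewrite !nth_shape; apply: shT.
by apply: contra T0 => /mapP[r rT /esym/size0nil <-].
Qed.

Lemma shape_geq n T : tableau n T -> sorted geq (shape T).
Proof.
by move=> tabT; have /andP[/and3P[]] := introT (tableauP n (shape T) T) (conj tabT erefl).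
Qed.

(** All shapes are generated together, so that sums unfold along the largest entry. The range of [i]
    includes [size T], the new bottom row. *)
Fixpoint tableaux (n : nat) : seq (seq (seq nat)) :=
  if n is n'.+1 then
    [seq add_cell n i T | T <- tableaux n',
                          i <- [seq i <- iota 0 (size T).+1 | addable (shape T) i]]
  else [:: [::]].

Lemma mem_tableaux n T : T \in tableaux n <-> tableau n T.
Proof.
elim: n T => [|n IHn] T.
  rewrite inE; split=> [/eqP->|[T0 _ /perm_size contT _ _]].
    by split=> // a; rewrite ?nth_nil // => b; rewrite nth_nil.
  case: T T0 contT => //= r T; rewrite inE negb_or size_cat => /andP[]; case: r => //.
split=> [/allpairsPdep[U [i [/IHn tabU]]]|tabT].
  rewrite mem_filter mem_iota add0n ltnS /= => /andP[add_i le_i] ->.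
  by apply/tableau_add=> //; apply: tableau_rows tabU.
have [U [i [le_i U0 eqT]]] := tableau_remove _ _ tabT.
move: tabT; rewrite eqT => /(tableau_add _ _ _ le_i U0)[tabU add_i].
apply/allpairsPdep; exists U, i; split=> //; first exact/IHn.
by rewrite mem_filter add_i mem_iota.
Qed.

Lemma tableau_notin n T : tableau n T -> n.+1 \notin flatten T.
Proof. by case=> _ _ /perm_mem eqT _ _; rewrite eqT mem_iota; lia. Qed.

Lemma tableaux_uniq n : uniq (tableaux n).
Proof.
elim: n => // n IHn; apply: allpairs_uniq_dep => // [T _|].
  exact/filter_uniq/iota_uniq.
move=> x y /allpairsPdep[T [i [/mem_tableaux tabT _ ->]]].
move=> /allpairsPdep[U [j [/mem_tableaux tabU _ ->]]] /=.
have [T0 _ _ _ _] := tabT; have [U0 _ _ _ _] := tabU.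
by case/add_cell_inj => //; try exact: tableau_notin; move=> -> ->.
Qed.

(** * Weights *)

(** Row [a] has [lambda_a - 1] cells outside column 0; giving each of them a factor [q ^+ a] spreads
    the power of [q] over the cells and makes the effect of a new cell local. *)
Definition cell_weight (R : comNzRingType) (q : R) T a b : R :=
  q ^+ a * qnum q (c_entry T a b).

Definition weight (R : comNzRingType) (q : R) (T : seq (seq nat)) : R :=
  \prod_(a < size T) \prod_(1 <= b < size (trow T a)) cell_weight R q T a b.

Lemma weightE (R : comNzRingType) (q : R) T :
  weight R q T = q ^+ partition_weight (shape T) * cq q (shape T) T.
Proof.
rewrite /partition_weight /cq expr_sum -big_split /= size_map big_mkord.
apply: eq_bigr => a _; rewrite nth_shape big_split /=; congr (_ * _).
by rewrite prodr_const_nat exprM.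
Qed.

(** Rows past the end give empty products; a common bound lets [T] and [add_cell k i T] be compared
    factor by factor even when a row is added. *)
Lemma weight_widen (R : comNzRingType) (q : R) T N : (size T <= N)%N ->
  weight R q T =
  \prod_(a < N) \prod_(1 <= b < size (trow T a)) cell_weight R q T a b.
Proof.
move=> le_N; rewrite /weight.
rewrite (big_ord_widen _ (fun a => \prod_(1 <= b < size (trow T a)) cell_weight R q T a b) le_N).
rewrite big_mkcond; apply: eq_bigr => a _; case: ltnP => // le_a.
by rewrite nth_default // big_geq.
Qed.

Lemma c_entry_widen T a b N : (size T <= N)%N -> c_entry T a b =
  count (fun i => (b.-1 < size (trow T i)) && (entry T i b.-1 < entry T a b))%N
        (iota a (N - a)).
Proof.
move=> le_N; rewrite /c_entry -(subnK (leq_sub2r a le_N)) addnC iotaD count_cat.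
rewrite [X in (_ + X)%N](_ : _ = 0%N) ?addn0 //; apply/eqP.
rewrite -leqn0 leqNgt -has_count -all_predC; apply/allP=> i.
rewrite mem_iota /= => /andP[le_i lt_i]; rewrite (@nth_default _ _ _ i) //.
by lia.
Qed.

Lemma c_entry_add n i T a b : perm_eq (flatten T) (iota 1 n) ->
  (0 < b < size (trow T a))%N ->
  c_entry (add_cell n.+1 i T) a b = c_entry T a b.
Proof.
move=> contT lt_b; have szU : size (add_cell n.+1 i T) = maxn i.+1 (size T).
  exact: size_set_nth.
rewrite (c_entry_widen T a b (maxn i.+1 (size T))) ?leq_maxr // /c_entry szU.
apply: eq_count => k; rewrite size_row_add !entry_add.
have -> : (a == i) && (b == size (trow T i)) = false.
  by apply/negP=> /andP[/eqP ai /eqP bi]; move: lt_b; rewrite bi ai ltnn andbF.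
have := entry_leq _ _ a b contT.
have [->|ne_ki] := eqVneq k i => /=; last by rewrite addn0.
by case: eqP; lia.
Qed.

(** Every old entry is below [n.+1], so a row counts as soon as it reaches the last old column of
    row [i], that is, when it is at least as long as row [i]. *)
Lemma c_entry_new n i T : tableau n T -> (i < size T)%N ->
  c_entry (add_cell n.+1 i T) i (size (trow T i)) = block (shape T) i.
Proof.
move=> [T0 _ contT _ _] lt_i; have row_i := row_neq0 _ _ T0 lt_i.
rewrite /block /c_entry size_set_nth (maxn_idPr lt_i).
have -> : drop i (shape T) = [seq nth 0%N (shape T) k | k <- iota i (size T - i)].
  by rewrite map_nth_iota ?size_map // take_oversize // size_drop size_map.
rewrite count_map; apply: eq_count => k /=; rewrite !nth_shape.
rewrite size_row_add !entry_add !eqxx /=.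
(* Row [i] being nonempty, its last old column is not that of the new cell, so the compared entries
   are all old. *)
rewrite [_ && (_.-1 == _)](_ : _ = false); last by lia.
rewrite (_ : entry _ _ _ < _)%N ?andbT; last by rewrite ltnS; apply: entry_leq.
by have [->|_] := eqVneq k i; lia.
Qed.

Lemma weight_add (R : comNzRingType) (q : R) n i T : tableau n T ->
  (i <= size T)%N -> weight R q (add_cell n.+1 i T) =
  (if (i < size T)%N then q ^+ i * qnum q (block (shape T) i) else 1) * weight R q T.
Proof.
move=> tabT le_i; have [T0 _ contT _ _] := tabT.
have szU : size (add_cell n.+1 i T) = maxn i.+1 (size T) by exact: size_set_nth.
rewrite (weight_widen R q T (maxn i.+1 (size T))) ?leq_maxr //.
rewrite /weight szU; have lt_i : (i < maxn i.+1 (size T))%N by lia.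
rewrite (bigD1 (Ordinal lt_i)) //= [in RHS](bigD1 (Ordinal lt_i)) //= mulrA.
congr (_ * _); last first.
  apply: eq_bigr => a ne_ai; rewrite size_row_add.
  rewrite [_ == _](_ : _ = false) ?addn0; last exact/negbTE.
  apply: eq_big_nat => b lt_b; congr (_ * qnum q _).
  exact: c_entry_add contT lt_b.
rewrite size_row_add eqxx addn1; case: ltnP => [lt_iT | le_Ti]; last first.
  (* The new cell lies in column 0, outside the range starting at 1, so both products are empty. *)
  by rewrite nth_default // !big_geq ?mulr1.
rewrite big_nat_recr /=; last exact: row_neq0.
rewrite mulrC /cell_weight (c_entry_new n) //; congr (_ * _).
apply: eq_big_nat => b lt_b; congr (_ * qnum q _).
exact: c_entry_add contT lt_b.
Qed.

(** * The q-Stirling recurrence and regrouping by shape *)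

Lemma sum_tableaux (R : comNzRingType) (q : R) n m :
  \sum_(T <- tableaux n | size T == m) weight R q T = qStirling2 q n m.
Proof.
elim: n m => [|n IHn] m.
  rewrite /= big_cons big_nil /= /weight big_ord0.
  by case: m => [|m]; rewrite ?addr0.
(* Testing [(size T).+1 == m] also covers [m = 0]: the first sum is then empty and [qnum q 0] is
   zero. *)
have step : \sum_(T <- tableaux n.+1 | size T == m) weight R q T
  = \sum_(T <- tableaux n | (size T).+1 == m) weight R q T
    + qnum q m * \sum_(T <- tableaux n | size T == m) weight R q T.
  rewrite mulr_sumr !(big_mkcond (fun T => _ == m)) -big_split.
  rewrite [LHS]big_allpairs_dep big_seq [RHS]big_seq.
  apply: eq_bigr => T /mem_tableaux tabT.
  rewrite big_filter -[iota _ _]/(index_iota 0 (size T).+1) big_mkcond.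
  (* The last index [size T] is the new bottom row, the only choice that changes the number of rows;
     it yields the first sum. *)
  rewrite big_nat_recr //= -big_mkcond /= addrC; congr (_ + _).
    have -> : addable (shape T) (size T).
      rewrite addableE; case: (posnP (size T)) => [->//|szT].
      rewrite [X in (size X < _)%N]nth_default // row_neq0 ?orbT ?prednK //.
      exact: tableau_rows tabT.
    rewrite size_set_nth (maxn_idPl (leqnSn _)).
    by rewrite (weight_add R q n) // ltnn mul1r.
  rewrite big_nat_cond.
  under eq_bigr => i /andP[/andP[_ lt_i] _].
    rewrite size_set_nth (maxn_idPr lt_i) (weight_add R q n) // ?(ltnW lt_i) //.
    rewrite lt_i; over.
  rewrite -big_nat_cond; case: eqP => [<-|_]; last by rewrite big1.
  by rewrite -mulr_suml -[in X in index_iota _ X](size_map size) sum_blocks ?size_map ?(shape_geq n).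
rewrite step !IHn; case: m {step} => [|m] /=.
  by rewrite big_pred0 // [qnum q 0]big_ord0 mul0r addr0.
congr (_ + _); rewrite -[RHS]IHn; exact: eq_bigl.
Qed.

(** A tableau determines its shape, so the families [Tab n lam] are disjoint and no tableau is
    listed twice. *)
Lemma perm_tableaux n :
  perm_eq (tableaux n) [seq T | lam <- partitions n, T <- Tab n lam].
Proof.
apply: uniq_perm; first exact: tableaux_uniq.
  apply: allpairs_uniq_dep; first exact: partitions_uniq.
    move=> lam; rewrite mem_partitions => /and3P[_ _ /eqP]; exact: Tab_uniq.
  move=> x y /allpairsPdep[lam [T [_ + ->]]] /allpairsPdep[mu [U [_ + ->]]] /=.
  by rewrite !mem_Tab => /and4P[/eqP<- _ _ _] /and4P[/eqP<- _ _ _] ->.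
move=> T; apply/idP/allpairsPdep => [/mem_tableaux tabT|[lam [U [lamP tabU ->]]]].
  have /andP[? ?] := introT (tableauP n (shape T) T) (conj tabT erefl).
  by exists (shape T), T; rewrite mem_partitions mem_Tab.
apply/mem_tableaux; move: lamP tabU; rewrite mem_partitions mem_Tab => lamP tabU.
by have /tableauP[] : is_partition n lam && is_standard_tableau n lam U by rewrite lamP.
Qed.

Theorem theorem3p11 (R : comNzRingType) (q : R) (n m : nat) :
  qStirling2 q n m =
  \sum_(lam <- partitions n | size lam == m)
     q ^+ partition_weight lam * \sum_(T <- Tab n lam) cq q lam T.
Proof.
rewrite -sum_tableaux (perm_big _ (perm_tableaux n)) /= big_mkcond.
rewrite big_allpairs_dep /= [RHS]big_mkcond; apply: eq_bigr => lam _.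
have shE T : T \in Tab n lam -> shape T = lam by rewrite mem_Tab => /and4P[/eqP].
rewrite mulr_sumr -big_mkcondr /= big_seq_cond.
(* Each member of [Tab n lam] has [size lam] rows, so the test on [size T] keeps either all of them
   or none. *)
case: eqP => [<-|ne_m].
  rewrite [RHS]big_seq; apply: eq_big => [T|T /andP[/shE <- _]]; last exact: weightE.
  by case: (boolP (T \in _)) => //= /shE <-; rewrite size_map eqxx.
by rewrite big1 // => T /andP[/shE eq_lam /eqP]; rewrite -(size_map size) -/(shape T) eq_lam.
Qed.
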